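(* Let $f$ be symmetric about $0$, monotonically decreasing on $[0,\infty)$, positive on $\mathbb{R}$ and continuous. Let $\mathbf{x}_n\in\mathbb{R}^n$, let $\tau_n=(s,\eta_{n,s})$ be a maximizer of $\mathrm{BIC}$ for $\mathbf{x}_n$, and let $g\in\mathbb{N}$. Write $L_{n,r}=L_{n,r}(\eta_{n,r},\mathbf{x}_n)$ for the maximal log-likelihood with $r$ components. (a) If $$\min_{r<s}\Big[L_{n,s}-L_{n,r}-\tfrac12(5g+3s-3r+2n)\log(n+g)+n\log n\Big]>0,$$ then $$B_n(\tau_n,\mathbf{x}_n)>\frac{g}{n+g}.$$ (b) If $$\min_{r<s}\Big[L_{n,s}-L_{n,r}-\tfrac32(s-r)\log(n+g)\Big]<0,$$ then $$B_n(\tau_n,\mathbf{x}_n)\le\frac{g}{n+g}.$$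
   Context: $f$ is a probability density on $\mathbb{R}$ and $f_{a,\sigma}(x)=\frac1\sigma f\big(\frac{x-a}{\sigma}\big)$. For $s\in\mathbb{N}$ and $\eta=(s,a_1,\dots,a_s,\sigma_1,\dots,\sigma_s,\pi_1,\dots,\pi_s)$ with $a_j\in\mathbb{R}$, $\pi_j\ge0$, $\sum_{j=1}^s\pi_j=1$, the log-likelihood is $$L_{n,s}(\eta,\mathbf{x}_n)=\sum_{i=1}^n\log\Big(\sum_{j=1}^s\pi_jf_{a_j,\sigma_j}(x_i)\Big),$$ and $\eta_{n,s}$ is a global maximizer of it under the restriction $\sigma_j\ge\sigma_0$, $j=1,\dots,s$, where $\sigma_0>0$ is a fixed constant not depending on $n$ or on the data. The number of components is estimated by maximizing over $s\in\mathbb{N}$ $$\mathrm{BIC}(s)=2L_{n,s}(\eta_{n,s},\mathbf{x}_n)-k\log n,\qquad k=3s-1.$$ Here $s$ in $\tau_n=(s,\eta_{n,s})$ denotes a maximizing number. Maximizers need not be unique; the result holds for any choice of maximizer for each dataset and sample size, defining a sequence of estimators $E_n(\mathbf{x}_n)=\tau_n$. The minima over $r<s$ run over numbers of components $r$ smaller than $s$ ($L_{n,0}$ is read as $-\infty$, so that a minimum over an empty set of $r\ge1$ is $+\infty$). Breakdown point for estimated number of components: let $s^*$ be the number of components of $E_n(\mathbf{x}_n)$ and $\mathbb{R}^+=(0,\infty)$. $B_n(E_n,\mathbf{x}_n)$ is the minimum of $\frac{g}{n+g}$ over all $g\in\mathbb{N}$ such that for every compact $C\subset\mathbb{R}^{s^*}\times(\mathbb{R}^+)^{s^*}$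 there is a dataset $\mathbf{x}_{n+g}=(x_1,\dots,x_n,x_{n+1},\dots,x_{n+g})$ extending $\mathbf{x}_n$ by $g$ real points such that for $\hat\eta=E_{n+g}(\mathbf{x}_{n+g})$ (with $\hat s$ components) there do not exist pairwise distinct indices $j_1,\dots,j_{s^*}\in\{1,\dots,\hat s\}$ with $(\hat a_{j_1},\dots,\hat a_{j_{s^*}},\hat\sigma_{j_1},\dots,\hat\sigma_{j_{s^*}})\in C$. In particular, breakdown occurs whenever $\hat s<s^*$. (Minimum over the empty set is read as $+\infty$.) *)

(* Defs.v *)
From mathcomp Require Import all_boot all_order all_algebra.
From mathcomp Require Import all_classical all_reals all_analysis.

Set Implicit Arguments.
Unset Strict Implicit.
Unset Printing Implicit Defensive.

Import Order.TTheory GRing.Theory Num.Theory.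
Import numFieldNormedType.Exports.

Local Open Scope classical_set_scope.
Local Open Scope ring_scope.

Definition is_density (R : realType) (f : R -> R) : Prop :=
  [/\ measurable_fun setT f, forall x, 0 <= f x
    & (\int[lebesgue_measure]_x (f x)%:E = 1)%E].

Definition loc_scale (R : realType) (f : R -> R) (a sigma x : R) : R :=
  sigma^-1 * f ((x - a) / sigma).

Record mixture (R : realType) (s : nat) := Mixture {
  locs : 'rV[R]_s;
  scales : 'rV[R]_s;
  weights : 'rV[R]_s }.

Definition mix_density (R : realType) (f : R -> R) (s : nat)
    (eta : mixture R s) (x : R) : R :=
  \sum_(j < s)
    weights eta 0 j * loc_scale f (locs eta 0 j) (scales eta 0 j) x.

Definition loglik (R : realType) (f : R -> R) (n s : nat) (x : 'rV[R]_n)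
    (eta : mixture R s) : R :=
  \sum_(i < n) ln (mix_density f eta (x 0 i)).

Definition admissible (R : realType) (sigma0 : R) (s : nat)
    (eta : mixture R s) : Prop :=
  [/\ forall j, 0 <= weights eta 0 j, \sum_(j < s) weights eta 0 j = 1
    & forall j, sigma0 <= scales eta 0 j].

Definition is_mle (R : realType) (f : R -> R) (sigma0 : R) (n s : nat)
    (x : 'rV[R]_n) (eta : mixture R s) : Prop :=
  admissible sigma0 eta /\
  forall eta' : mixture R s, admissible sigma0 eta' ->
    loglik f x eta' <= loglik f x eta.

Definition BIC (R : realType) (f : R -> R) (n s : nat) (x : 'rV[R]_n)
    (eta : mixture R s) : R :=
  2 * loglik f x eta - (3 * s%:R - 1) * ln n%:R.

Definition maximizes_BIC (R : realType) (f : R -> R)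
    (eta : forall n s : nat, 'rV[R]_n -> mixture R s)
    (n : nat) (x : 'rV[R]_n) (s : nat) : Prop :=
  (0 < s)%N /\
  forall r : nat, (0 < r)%N -> BIC f x (eta n r x) <= BIC f x (eta n s x).

Definition estimator (R : realType) :=
  forall n : nat, 'rV[R]_n -> {s : nat & mixture R s}.

Definition BIC_estimator (R : realType)
    (eta : forall n s : nat, 'rV[R]_n -> mixture R s)
    (shat : forall n : nat, 'rV[R]_n -> nat) : estimator R :=
  fun n x => existT (mixture R) (shat n x) (eta n (shat n x) x).

(* A compact subset of R^s x (R^+)^s is a compact subset of R^s x R^s all of
   whose points have positive scale coordinates: in particular it stays away
   from scale 0. *)
Definition compact_params (R : realType) (s : nat)
    (C : set ('rV[R]_s * 'rV[R]_s)) : Prop :=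
  compact C /\ forall p, C p -> forall k, 0 < p.2 0 k.

Definition has_components_in (R : realType) (s t : nat)
    (C : set ('rV[R]_s * 'rV[R]_s)) (eta : mixture R t) : Prop :=
  exists2 j : 'I_s -> 'I_t, injective j &
    C (\row_k locs eta 0 (j k), \row_k scales eta 0 (j k)).

Definition breaks_down (R : realType) (E : estimator R) (n : nat)
    (x : 'rV[R]_n) (g : nat) : Prop :=
  forall C : set ('rV[R]_(projT1 (E n x)) * 'rV[R]_(projT1 (E n x))),
    compact_params C ->
    exists y : 'rV[R]_g,
      ~ has_components_in C (projT2 (E (n + g)%N (row_mx x y))).

(* For [0 < n] the map g |-> g / (n + g) is increasing, so the infimum is a
   minimum when the set is nonempty; it is [+oo] on the empty set. [g = 0]
   never contributes as soon as the scales of [E n x] are positive. *)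
Definition breakdown_point (R : realType) (E : estimator R) (n : nat)
    (x : 'rV[R]_n) : \bar R :=
  ereal_inf [set (g%:R / (n + g)%:R)%:E | g in [set g | breaks_down E x g]].

(* No mixture of order 0 is admissible, so [eta n 0 x] is a junk value and
   L_{n,0} is -oo by convention. *)
Definition maxL (R : realType) (f : R -> R)
    (eta : forall n s : nat, 'rV[R]_n -> mixture R s)
    (n : nat) (x : 'rV[R]_n) (r : nat) : \bar R :=
  if r == 0%N then -oo%E else (loglik f x (eta n r x))%:E.

(* Main.v *)
Require Import Defs.
From mathcomp Require Import all_boot all_order all_algebra.
From mathcomp Require Import all_classical all_reals all_analysis.
From mathcomp Require Import ring lra.

Set Implicit Arguments.
Unset Strict Implicit.
Unset Printing Implicit Defensive.

Import Order.TTheory GRing.Theory Num.Theory.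
Import numFieldNormedType.Exports.

Local Open Scope classical_set_scope.
Local Open Scope ring_scope.

(* Let M = f(0) / sigma0, the largest value of an admissible mixture density.
   If fewer than s components of the fit to the n + g points stay in a large
   box, the components outside it contribute almost nothing at the points of x,
   so the log-likelihood is at most about L_{n,r} + g ln M for the number r < s
   of components inside, and is arbitrarily low if r = 0. Competing with it is
   the optimal s-mixture on x, weighted n / (n + g), together with one component
   of scale sigma0 and weight 1 / (n + g) at each added point. Comparing BICs
   gives (a); as its hypothesis weakens when g decreases, no smaller g breaks the
   estimator down either.
   For (b), put all g points at a single far location. The optimal r-mixture on x
   with one extra spike of weight g / (n + g) there is nearly as likely as any fit
   having r components near x. A fit keeping m >= s components in a given compact
   set must spend another one on the far points; by Gibbs' inequality its weights
   cannot be better than n / (n + g) and g / (n + g), and optimality of s for x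
   gives L_{n,m} - L_{n,s} <= 3/2 (m - s) ln n, so its BIC is lower. *)

(** * Inequalities for sums of logarithms *)

Section LogSums.
Variable R : realType.

Lemma ln_addr_le (u d : R) : 0 < u -> 0 <= d -> ln (u + d) <= ln u + d / u.
Proof.
move=> u0 d0; have du0 : 0 <= d / u by rewrite divr_ge0 // ltW.
have -> : u + d = u * (1 + d / u) by rewrite mulrDr mulr1 mulrC divfK // gt_eqF.
rewrite lnM ?posrE //; last by rewrite ltr_pwDl.
by rewrite lerD2l le_ln1Dx // (lt_le_trans _ du0) // ltrN10.
Qed.

Lemma ler_ln_pos (u v : R) : 0 < u -> u <= v -> ln u <= ln v.
Proof. by move=> u0 uv; rewrite ler_ln ?posrE // (lt_le_trans u0). Qed.

(* [ln] is not uniformly continuous near 0; the first alternative absorbs the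
   case of a small A i, which makes [d] uniform in [A]. *)
Lemma sum_ln_perturb (n : nat) (M eps l : R) : 0 < M -> 0 < eps ->
  exists2 d : R, 0 < d & forall A B : 'I_n -> R,
    (forall i, 0 <= A i <= M) -> (forall i, 0 < B i <= A i + d) ->
    \sum_(i < n) ln (B i) <= l \/
    (forall i, 0 < A i) /\
      \sum_(i < n) ln (B i) <= \sum_(i < n) ln (A i) + eps.
Proof.
move=> M0 eps0; pose b := `|ln (M + 1)|.
(* If some [A i] is below [c], then [B i <= 2 * c] has logarithm at most [l - n%:R * b] and every
   other term is at most [b], so the sum is at most [l]. Otherwise each term grows by at most
   [d / c], in total by at most [eps]. *)
pose c := expR (l - n%:R * b) / 2.
have c0 : 0 < c by rewrite divr_gt0 ?expR_gt0.
pose d := Num.min (Num.min 1 c) (eps * c / n.+1%:R).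
have d0 : 0 < d by rewrite !lt_min ltr01 c0 divr_gt0 // mulr_gt0.
have d1 : d <= 1 by rewrite !ge_min lexx.
have dc : d <= c by rewrite !ge_min lexx orbT.
have dn : d <= eps * c / n.+1%:R by rewrite !ge_min lexx !orbT.
exists d => // A B AM BA.
have [/forallP cA|/forallPn[i]] := boolP [forall i, c <= A i]; last first.
  rewrite -ltNge => Aic; left.
  have lnB j : ln (B j) <= b.
    have /andP[B0 BAj] := BA j; have /andP[A0 AMj] := AM j.
    by rewrite (le_trans _ (ler_norm _)) // ler_ln_pos //; lra.
  have lnBi : ln (B i) <= l - n%:R * b.
    rewrite -(expRK (l - n%:R * b)) ler_ln_pos //; first by case/andP: (BA i).
    have /andP[B0 BAi] := BA i; apply: (le_trans BAi).
    by rewrite /c in dc Aic; lra.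
  rewrite (bigD1 i) //=.
  have : \sum_(j < n | j != i) ln (B j) <= \sum_(j < n) b.
    rewrite [leRHS](bigD1 i) //= -[leLHS]add0r lerD ?normr_ge0 //.
    by apply: ler_sum => j _.
  rewrite sumr_const card_ord -mulr_natl; lra.
have A0 i : 0 < A i by rewrite (lt_le_trans c0).
right; split => //.
have -> : \sum_(i < n) ln (A i) + eps =
    \sum_(i < n) (ln (A i) + d / c) + (eps - n%:R * (d / c)).
  by rewrite big_split /= sumr_const card_ord -mulr_natl; lra.
apply: ler_wpDr.
  rewrite subr_ge0 mulrA ler_pdivrMr //.
  apply: le_trans (_ : n.+1%:R * d <= _); last first.
    by rewrite mulrC -ler_pdivlMr.
  by rewrite ler_wpM2r ?ler_nat // ltW.
apply: ler_sum => i _; have /andP[B0 BAi] := BA i.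
apply: le_trans (ler_ln_pos B0 BAi) _.
apply: le_trans (ln_addr_le (A0 i) (ltW d0)) _.
by rewrite lerD2l ler_wpM2l ?(ltW d0) // lef_pV2 ?posrE.
Qed.

(** Apply [ln u <= u - 1] to the ratio of each weight to its optimal value; the two error terms
    cancel. *)
Lemma gibbs2 (p q W : R) : 0 < p -> 0 < q -> 0 < W -> W < 1 ->
  p * ln W + q * ln (1 - W) <= p * ln (p / (p + q)) + q * ln (q / (p + q)).
Proof.
move=> p0 q0 W0 W1; have W'0 : 0 < 1 - W by lra.
have pq0 : 0 < p + q by lra.
have key r V : 0 < r -> 0 < V ->
    r * ln V <= r * ln (r / (p + q)) + (V * (p + q) - r).
  move=> r0 V0; set v := r / (p + q).
  have v0 : 0 < v by rewrite divr_gt0.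
  have : ln (V / v) <= V / v - 1.
    by rewrite -{1}(subrKC 1 (V / v)) le_ln1Dx // ltrBrDr addNr divr_gt0.
  rewrite ln_div ?posrE // => /(ler_wpM2l (ltW r0)).
  have -> : r * (V / v - 1) = V * (p + q) - r by rewrite /v; field; rewrite !gt_eqF.
  lra.
have := key _ _ p0 W0; have := key _ _ q0 W'0; lra.
Qed.

End LogSums.

(** * Decay of a symmetric unimodal density *)

Section Kernel.
Variables (R : realType) (f : R -> R).
Hypothesis f_density : is_density f.
Hypothesis f_sym : forall x, f (- x) = f x.
Hypothesis f_decr : forall x y, 0 <= x -> x <= y -> f y <= f x.

Lemma kernel_norm x : f `|x| = f x.
Proof. by case: (ger0P x). Qed.

Lemma kernel_max x : f x <= f 0.
Proof. by rewrite -kernel_norm f_decr. Qed.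

(** By monotonicity [K * f K] is at most the integral of [f] over [0, K], hence at most 1; take
    [K = eps^-1]. *)
Lemma kernel_vanishes (eps : R) : 0 < eps ->
  exists2 K, 0 < K & forall x, K <= `|x| -> f x <= eps.
Proof.
move=> eps0; exists eps^-1; rewrite ?invr_gt0 // => x Kx.
have K0 : 0 < eps^-1 by rewrite invr_gt0.
rewrite -kernel_norm; apply: le_trans (f_decr (ltW K0) Kx) _.
case: f_density => fm f0 f1; set K := eps^-1.
have : (\int[lebesgue_measure]_(x in `[0%R, K]) (f K)%:E <= 1)%E.
  rewrite -f1.
  apply: (@le_trans _ _ (\int[lebesgue_measure]_(x in `[0%R, K]) (f x)%:E)%E).
    apply: ge0_le_integral => //=.
    - by move=> y _; rewrite lee_fin.
    - by apply/measurable_realfun.measurable_EFinP; apply: measurable_funTS.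
    - by move=> y /=; rewrite in_itv /= lee_fin => /andP[y0 yK]; exact: f_decr.
  apply: ge0_subset_integral => //=; first exact/measurable_realfun.measurable_EFinP.
  by move=> y _; rewrite lee_fin.
rewrite integral_cst //= lebesgue_measure_itv /= lte_fin K0 -EFinB subr0.
by rewrite -EFinM lee_fin /K -ler_pdivlMr // invrK mul1r.
Qed.

End Kernel.

(** * Location-scale mixtures with scales bounded below *)

Section Mixtures.
Variables (R : realType) (f : R -> R) (sigma0 : R).
Hypothesis f_density : is_density f.
Hypothesis f_sym : forall x, f (- x) = f x.
Hypothesis f_decr : forall x y, 0 <= x -> x <= y -> f y <= f x.
Hypothesis f_pos : forall x, 0 < f x.
Hypothesis sigma0_gt0 : 0 < sigma0.

Lemma mulr_natl_sum (n : nat) (c : R) : n%:R * c = \sum_(i < n) c.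
Proof. by rewrite sumr_const card_ord mulr_natl. Qed.

Lemma peak_gt0 : 0 < f 0 / sigma0.
Proof. exact: divr_gt0. Qed.

Lemma loc_scale_gt0 (a sigma x : R) : 0 < sigma -> 0 < loc_scale f a sigma x.
Proof. by move=> s0; rewrite mulr_gt0 ?invr_gt0. Qed.

(** With [b = sigma0] this bounds the peak; with [b] large it says that wide components are flat. *)
Lemma loc_scale_le (b a sigma x : R) : 0 < b -> b <= sigma ->
  loc_scale f a sigma x <= f 0 / b.
Proof.
move=> b0 bs; have s0 := lt_le_trans b0 bs.
rewrite mulrC ler_pM ?invr_ge0 ?(ltW s0) ?(ltW (f_pos _)) //.
  by rewrite lef_pV2 ?posrE.
exact: kernel_max.
Qed.

Lemma loc_scale_center (a sigma : R) : loc_scale f a sigma a = f 0 / sigma.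
Proof. by rewrite /loc_scale subrr mul0r mulrC. Qed.

Lemma loc_scale_vanishes (K d : R) : 0 < d ->
  exists D : R, forall a sigma x, sigma0 <= sigma <= K -> D <= `|x - a| ->
    loc_scale f a sigma x <= d.
Proof.
move=> d0; have ds0 : 0 < d * sigma0 by rewrite mulr_gt0.
have [T T0 fT] := kernel_vanishes f_density f_sym f_decr ds0.
exists (T * K) => a sigma x /andP[s0s sK] TKx.
have s0 : 0 < sigma by exact: lt_le_trans s0s.
rewrite /loc_scale mulrC ler_pdivrMr //.
apply: (@le_trans _ _ (d * sigma0)); last by rewrite ler_pM2l.
apply: fT; rewrite normrM normfV (gtr0_norm s0) ler_pdivlMr //.
by apply: le_trans TKx; rewrite ler_pM2l.
Qed.

(** Admissibility already keeps the scale above [sigma0]. *)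
Definition in_box (K1 K2 a sigma : R) : bool := (`|a| <= K2) && (sigma <= K1).

(** A component leaves the box either by a large scale, which makes it flat, or by a far location
    with a scale at most [K1]; hence [K2] is chosen after [K1]. The parameter [b] lets the box cover
    a given compact set. *)
Lemma loc_scale_off_box (X b d : R) : 0 < d ->
  exists K1 K2 : R, [/\ b <= K1, b <= K2 & forall a sigma x,
    sigma0 <= sigma -> `|x| <= X -> ~~ in_box K1 K2 a sigma ->
    loc_scale f a sigma x <= d].
Proof.
move=> d0; have m0 : 0 < f 0 / d by rewrite divr_gt0.
pose K1 := Num.max b (f 0 / d).
have [D farD] := loc_scale_vanishes K1 d0.
exists K1, (Num.max b (D + X)); split; rewrite ?le_max ?lexx //.
move=> a sigma x s0s xX; rewrite negb_and -!ltNge.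
have [K1s _|sK1] := ltP K1 sigma.
  have ms : f 0 / d <= sigma by rewrite (le_trans _ (ltW K1s)) ?le_max ?lexx ?orbT.
  apply: le_trans (loc_scale_le _ _ m0 ms) _.
  by rewrite invf_div mulrC divfK // gt_eqF.
rewrite orbF gt_max => /andP[_ DXa]; apply: farD; first by rewrite s0s.
have := lerB_dist a x; rewrite distrC; lra.
Qed.

Section Admissible.
Variables (s : nat) (eta : mixture R s).
Hypothesis eta_adm : admissible sigma0 eta.

Let scale_gt0 j : 0 < scales eta 0 j.
Proof. by case: eta_adm => _ _ /(_ j); exact: lt_le_trans. Qed.

Lemma mix_term_ge0 j x :
  0 <= weights eta 0 j * loc_scale f (locs eta 0 j) (scales eta 0 j) x.
Proof.
case: eta_adm => w0 _ _.
by rewrite mulr_ge0 // ltW // loc_scale_gt0.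
Qed.

Lemma mix_density_gt0 x : 0 < mix_density f eta x.
Proof.
rewrite lt_neqAle sumr_ge0 => [|j _]; last exact: mix_term_ge0.
rewrite andbT; apply/eqP => /esym m0.
case: eta_adm => _ w1 _; move/eqP: w1; rewrite big1 ?(eq_sym 0) ?oner_eq0 //.
move=> j _; have /eqP := m0; rewrite psumr_eq0 => [/allP|k _]; last first.
  exact: mix_term_ge0.
move=> /(_ j); rewrite mem_index_enum => /(_ isT); rewrite implyTb mulf_eq0.
by rewrite (gt_eqF (loc_scale_gt0 _ _ _)) // orbF => /eqP.
Qed.

Lemma partial_weight_ge0 (N : {set 'I_s}) : 0 <= \sum_(j in N) weights eta 0 j.
Proof. by case: eta_adm => w0 _ _; exact: sumr_ge0. Qed.

Lemma partial_weightC (N : {set 'I_s}) :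
  \sum_(j in ~: N) weights eta 0 j = 1 - \sum_(j in N) weights eta 0 j.
Proof.
case: eta_adm => _ <- _; rewrite [in RHS](bigID (mem N)) /= addrC addrK.
by apply: eq_bigl => j; rewrite inE.
Qed.

Lemma partial_weight_le1 (N : {set 'I_s}) : \sum_(j in N) weights eta 0 j <= 1.
Proof. by rewrite -subr_ge0 -partial_weightC partial_weight_ge0. Qed.

Lemma partial_density_le (N : {set 'I_s}) (x b : R) :
  (forall j, j \in N -> loc_scale f (locs eta 0 j) (scales eta 0 j) x <= b) ->
  \sum_(j in N) weights eta 0 j * loc_scale f (locs eta 0 j) (scales eta 0 j) x
    <= (\sum_(j in N) weights eta 0 j) * b.
Proof.
case: eta_adm => w0 _ _ Nb; rewrite mulr_suml; apply: ler_sum => j jN.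
by rewrite ler_wpM2l // Nb.
Qed.

Lemma mix_density_split (N : {set 'I_s}) (x : R) :
  mix_density f eta x =
  \sum_(j in N) weights eta 0 j * loc_scale f (locs eta 0 j) (scales eta 0 j) x
  + \sum_(j in ~: N)
      weights eta 0 j * loc_scale f (locs eta 0 j) (scales eta 0 j) x.
Proof.
rewrite /mix_density (bigID (mem N)) /=; congr (_ + _).
by apply: eq_bigl => j; rewrite inE.
Qed.

Lemma loc_scale_le_peak j x :
  loc_scale f (locs eta 0 j) (scales eta 0 j) x <= f 0 / sigma0.
Proof. by case: eta_adm => _ _ ?; exact: loc_scale_le. Qed.

Lemma mix_density_le_add (N : {set 'I_s}) (x d : R) : 0 <= d ->
  (forall j, j \notin N -> loc_scale f (locs eta 0 j) (scales eta 0 j) x <= d) ->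
  mix_density f eta x <= \sum_(j in N)
    weights eta 0 j * loc_scale f (locs eta 0 j) (scales eta 0 j) x + d.
Proof.
move=> d0 Nd; rewrite (mix_density_split N) lerD2l.
apply: le_trans (partial_density_le (b := d) _) _.
  by move=> j; rewrite inE; exact: Nd.
by rewrite ler_piMl // partial_weight_le1.
Qed.

Lemma mix_density_le_peak x : mix_density f eta x <= f 0 / sigma0.
Proof.
case: (eta_adm) => w0 w1 _; rewrite -[leRHS]mul1r -w1 mulr_suml.
by apply: ler_sum => j _; rewrite ler_wpM2l // loc_scale_le_peak.
Qed.

Lemma loglik_le_peak n (x : 'rV[R]_n) :
  loglik f x eta <= n%:R * ln (f 0 / sigma0).
Proof.
rewrite mulr_natl_sum; apply: ler_sum => i _.
by rewrite ler_ln_pos ?mix_density_gt0 ?mix_density_le_peak.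
Qed.

End Admissible.

(** * Log-likelihoods of restricted and of spiked mixtures *)

Lemma loglik_row_mx (s n g : nat) (eta : mixture R s) (x : 'rV[R]_n)
    (y : 'rV[R]_g) :
  loglik f (row_mx x y) eta = loglik f x eta + loglik f y eta.
Proof.
rewrite /loglik big_split_ord /=.
by congr (_ + _); apply: eq_bigr => i _; rewrite ?row_mxEl ?row_mxEr.
Qed.

(** The mixture conditioned on its component lying in [N]; its order [#|N|] lets it compete for the
    maximal likelihood of that order. *)
Definition sub_mixture (s : nat) (eta : mixture R s) (N : {set 'I_s}) :
    mixture R #|N| :=
  Mixture (\row_k locs eta 0 (enum_val k)) (\row_k scales eta 0 (enum_val k))
    (\row_k (weights eta 0 (enum_val k) / \sum_(j in N) weights eta 0 j)).

Lemma sub_mixture_admissible (s : nat) (eta : mixture R s) (N : {set 'I_s}) :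
  admissible sigma0 eta -> 0 < \sum_(j in N) weights eta 0 j ->
  admissible sigma0 (sub_mixture eta N).
Proof.
move=> [w0 w1 sc] W0; split => [k||k]; rewrite ?mxE //=.
  by rewrite divr_ge0 // ltW.
under eq_bigr do rewrite mxE.
rewrite -(big_enum_val (fun j => weights eta 0 j / _)) -mulr_suml.
by rewrite divff // gt_eqF.
Qed.

Lemma mix_density_sub (s : nat) (eta : mixture R s) (N : {set 'I_s}) x :
  0 < \sum_(j in N) weights eta 0 j ->
  \sum_(j in N) weights eta 0 j * loc_scale f (locs eta 0 j) (scales eta 0 j) x
  = (\sum_(j in N) weights eta 0 j) * mix_density f (sub_mixture eta N) x.
Proof.
move=> W0; rewrite big_enum_val mulr_sumr; apply: eq_bigr => k _.
by rewrite !mxE [RHS]mulrA [X in _ = X * _]mulrCA divff ?gt_eqF // mulr1.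
Qed.

Lemma sub_mixture_card_gt0 (s : nat) (eta : mixture R s) (N : {set 'I_s}) :
  0 < \sum_(j in N) weights eta 0 j -> (0 < #|N|)%N.
Proof.
move=> W0; rewrite card_gt0; apply/eqP => N0.
by move: W0; rewrite N0 big_set0 ltxx.
Qed.

(** Factoring the total weight of [N] out of the density at each point produces the [n%:R * ln]
    term. It matters that [d] precedes [s], [eta] and [N]: the box must be fixed before the added
    points, on which the fit depends. *)
Lemma loglik_drop_far (n : nat) (x : 'rV[R]_n) (eps l : R) :
  (0 < n)%N -> 0 < eps ->
  exists2 d : R, 0 < d & forall s (eta : mixture R s) (N : {set 'I_s}),
    admissible sigma0 eta ->
    (forall i j, j \notin N ->
       loc_scale f (locs eta 0 j) (scales eta 0 j) (x 0 i) <= d) ->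
    loglik f x eta <= l \/
    0 < \sum_(j in N) weights eta 0 j /\
    loglik f x eta <= n%:R * ln (\sum_(j in N) weights eta 0 j)
                      + loglik f x (sub_mixture eta N) + eps.
Proof.
move=> n0 eps0; have [d d0 dP] := sum_ln_perturb n l peak_gt0 eps0.
exists d => // s eta N adm far.
pose A i := \sum_(j in N)
  weights eta 0 j * loc_scale f (locs eta 0 j) (scales eta 0 j) (x 0 i).
pose W := \sum_(j in N) weights eta 0 j.
have A_ge0 i : 0 <= A i by apply: sumr_ge0 => j _; exact: mix_term_ge0.
have A_le i : A i <= W * (f 0 / sigma0).
  by apply: partial_density_le => // j _; exact: loc_scale_le_peak.
have p0 := ltW peak_gt0.
have [||?|[Apos lnle]] := dP A (fun i => mix_density f eta (x 0 i)).
- move=> i; rewrite A_ge0 (le_trans (A_le i)) // ler_piMl //.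
  exact: partial_weight_le1.
- move=> i; rewrite mix_density_gt0 // mix_density_le_add //; first exact: ltW.
  by move=> j; exact: far.
- by left.
have W0 : 0 < W.
  rewrite -(pmulr_lgt0 _ peak_gt0); apply: lt_le_trans (A_le (Ordinal n0)).
  exact: Apos.
right; split => //; apply: (le_trans lnle); rewrite lerD2r.
rewrite mulr_natl_sum -big_split /=.
apply: ler_sum => i _; rewrite /A mix_density_sub // lnM ?posrE //.
by apply: mix_density_gt0; exact: sub_mixture_admissible.
Qed.

(** Used with one spike of weight 1 / (n + g) per added point in (a), and with a single spike of
    weight g / (n + g) in (b). *)
Definition spiked (s k : nat) (eta : mixture R s) (y : 'rV[R]_k) (w : R) :
    mixture R (s + k) :=
  Mixture (row_mx (locs eta) y) (row_mx (scales eta) (const_mx sigma0))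
    (row_mx ((1 - k%:R * w) *: weights eta) (const_mx w)).

Lemma spiked_admissible (s k : nat) (eta : mixture R s) (y : 'rV[R]_k) (w : R) :
  admissible sigma0 eta -> 0 <= w -> k%:R * w <= 1 ->
  admissible sigma0 (spiked eta y w).
Proof.
move=> [w0 w1 sc] w_ge0 kw; split.
- move=> j /=; case: (split_ordP j) => i ->; rewrite ?row_mxEl ?row_mxEr !mxE //.
  by rewrite mulr_ge0 // subr_ge0.
- rewrite big_split_ord /=.
  under eq_bigr do rewrite row_mxEl mxE.
  under [X in _ + X]eq_bigr do rewrite row_mxEr mxE.
  by rewrite -mulr_sumr w1 -mulr_natl_sum mulr1 subrK.
- by move=> j /=; case: (split_ordP j) => i ->; rewrite ?row_mxEl ?row_mxEr ?mxE.
Qed.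

Lemma mix_density_spiked (s k : nat) (eta : mixture R s) (y : 'rV[R]_k)
    (w x : R) :
  mix_density f (spiked eta y w) x =
  (1 - k%:R * w) * mix_density f eta x
  + \sum_(j < k) w * loc_scale f (y 0 j) sigma0 x.
Proof.
rewrite /mix_density big_split_ord /= mulr_sumr.
congr (_ + _); apply: eq_bigr => j _; last by rewrite !row_mxEr !mxE.
by rewrite !row_mxEl !mxE -mulrA.
Qed.

(** At the points of [x] discard the spikes; at each point of [z] keep only the spike centred
    there. *)
Lemma loglik_spiked_ge (s k n g : nat) (eta : mixture R s) (x : 'rV[R]_n)
    (y : 'rV[R]_k) (z : 'rV[R]_g) (w : R) :
  admissible sigma0 eta -> 0 < w -> k%:R * w < 1 ->
  (forall i, exists j, z 0 i = y 0 j) ->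
  n%:R * ln (1 - k%:R * w) + loglik f x eta + g%:R * ln (w * (f 0 / sigma0))
  <= loglik f (row_mx x z) (spiked eta y w).
Proof.
move=> adm w0 kw zy; rewrite loglik_row_mx.
have kw' : 0 < 1 - k%:R * w by rewrite subr_gt0.
have spike_ge0 u j : 0 <= w * loc_scale f (y 0 j) sigma0 u.
  by rewrite mulr_ge0 // ltW // loc_scale_gt0.
apply: lerD.
  rewrite mulr_natl_sum -big_split /=.
  apply: ler_sum => i _; have m0 := mix_density_gt0 adm (x 0 i).
  rewrite -lnM ?posrE // ler_ln_pos ?mulr_gt0 // mix_density_spiked.
  by rewrite lerDl sumr_ge0.
rewrite mulr_natl_sum.
apply: ler_sum => i _; rewrite ler_ln_pos ?(mulr_gt0 w0 peak_gt0) //.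
have [j ->] := zy i; rewrite mix_density_spiked (bigD1 j) //= loc_scale_center.
rewrite addrCA lerDl addr_ge0 ?sumr_ge0 //.
by rewrite mulr_ge0 ?(ltW kw') // ltW // mix_density_gt0.
Qed.

End Mixtures.

(** * Compact parameter sets, boxes and finite bounds *)

Lemma compact_fun_bounded (R : realType) (T : topologicalType) (h : T -> R)
    (C : set T) :
  compact C -> continuous h -> exists b, forall p, C p -> `|h p| <= b.
Proof.
move=> cC ch.
have [M [_ MP]] := compact_bounded (continuous_compact (continuous_subspaceT ch) cC).
exists (M + 1) => p Cp; apply: (MP (M + 1)); first by rewrite ltrDl.
by exists p.
Qed.

Lemma compact_params_bounded (R : realType) (s : nat)
    (C : set ('rV[R]_s * 'rV[R]_s)) : compact_params C ->
  exists b : R, forall p, C p -> forall k, `|p.1 0 k| <= b /\ p.2 0 k <= b.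
Proof.
move=> [cC _].
have /choice[b1 b1P] : forall k : 'I_s, exists b, forall p, C p -> `|p.1 0 k| <= b.
  move=> k; have ck : continuous (fun p : 'rV[R]_s * 'rV[R]_s => p.1 0 k).
    move=> p; apply: (@continuous_comp _ _ _ fst (fun v : 'rV[R]_s => v 0 k)).
      exact: cvg_fst.
    exact: coord_continuous.
  exact: compact_fun_bounded cC ck.
have /choice[b2 b2P] : forall k : 'I_s, exists b, forall p, C p -> `|p.2 0 k| <= b.
  move=> k; have ck : continuous (fun p : 'rV[R]_s * 'rV[R]_s => p.2 0 k).
    move=> p; apply: (@continuous_comp _ _ _ snd (fun v : 'rV[R]_s => v 0 k)).
      exact: cvg_snd.
    exact: coord_continuous.
  exact: compact_fun_bounded cC ck.
exists (Num.max (\big[Num.max/0]_k b1 k) (\big[Num.max/0]_k b2 k)) => p Cp k.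
rewrite !le_max; split.
  by rewrite (le_trans (b1P _ _ Cp)) // (le_bigmax _ b1).
apply/orP; right; apply: le_trans (ler_norm _) _.
by rewrite (le_trans (b2P _ _ Cp)) // (le_bigmax _ b2).
Qed.

Definition box_params (R : realType) (s : nat) (sigma0 K1 K2 : R) :
    set ('rV[R]_s * 'rV[R]_s) :=
  [set v : 'rV[R]_s | forall k, v 0 k \in `[- K2, K2]] `*`
  [set v : 'rV[R]_s | forall k, v 0 k \in `[sigma0, K1]].

Lemma box_params_compact (R : realType) (s : nat) (sigma0 K1 K2 : R) :
  0 < sigma0 -> compact_params (@box_params R s sigma0 K1 K2).
Proof.
move=> s0; split.
  apply: compact_setX.
    by apply: (@rV_compact R s (fun=> `[- K2, K2]%classic)) => k; exact: segment_compact.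
  by apply: (@rV_compact R s (fun=> `[sigma0, K1]%classic)) => k; exact: segment_compact.
move=> p [_ /= sc] k; have := sc k; rewrite /= in_itv /= => /andP[+ _].
exact: lt_le_trans.
Qed.

Lemma row_bounded (R : realType) (n : nat) (x : 'rV[R]_n) :
  exists X : R, forall i, `|x 0 i| <= X.
Proof.
exists (\sum_i `|x 0 i|) => i; rewrite (bigD1 i) //= lerDl.
exact: sumr_ge0.
Qed.

(** The initial value 1 covers an empty [P], and halving the minimum makes the bound strict. *)
Lemma positive_lower_bound (R : realType) (I : finType) (P : pred I) (F : I -> R) :
  (forall i, P i -> 0 < F i) ->
  exists2 eps : R, 0 < eps & forall i, P i -> eps < F i.
Proof.
move=> F0; exists ((\big[Num.min/1]_(i | P i) F i) / 2).
  by rewrite divr_gt0 // lt_bigmin.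
move=> i Pi; rewrite ltr_pdivrMr // mulr2n mulrDr mulr1.
have := @bigmin_le_cond _ _ _ 1 _ _ F Pi; have := F0 _ Pi; lra.
Qed.

(** * BIC comparisons giving the two breakdown criteria *)

Section Breakdown.
Variables (R : realType) (f : R -> R) (sigma0 : R).
Hypothesis f_density : is_density f.
Hypothesis f_sym : forall x, f (- x) = f x.
Hypothesis f_decr : forall x y, 0 <= x -> x <= y -> f y <= f x.
Hypothesis f_pos : forall x, 0 < f x.
Hypothesis sigma0_gt0 : 0 < sigma0.
Variable eta : forall n s : nat, 'rV[R]_n -> mixture R s.
Arguments eta : clear implicits.
Hypothesis eta_mle : forall (n s : nat) (x : 'rV[R]_n), (0 < n)%N -> (0 < s)%N ->
  is_mle f sigma0 x (eta n s x).
Variable shat : forall n : nat, 'rV[R]_n -> nat.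
Arguments shat : clear implicits.
Hypothesis shat_max : forall (n : nat) (x : 'rV[R]_n), (0 < n)%N ->
  maximizes_BIC f eta x (shat n x).

Lemma shat_gt0 n (x : 'rV[R]_n) : (0 < n)%N -> (0 < shat n x)%N.
Proof. by move=> n0; case: (shat_max x n0). Qed.

Lemma shat_optimal n (x : 'rV[R]_n) u (zeta : mixture R u) :
  (0 < n)%N -> (0 < u)%N -> admissible sigma0 zeta ->
  loglik f x zeta - 3 / 2 * u%:R * ln n%:R <=
  loglik f x (eta n (shat n x) x) - 3 / 2 * (shat n x)%:R * ln n%:R.
Proof.
move=> n0 u0 adm; have [_ /(_ u u0)] := shat_max x n0.
have [_ /(_ zeta adm)] := eta_mle x n0 u0; rewrite /BIC; lra.
Qed.

(** In the constant, [5 * g] is [2 * g], from the spike weights 1 / (n + g), plus [3 * g], from the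
    penalty for g extra components. The peak terms [g%:R * ln (f 0 / sigma0)] of fit and competitor
    cancel. *)
Lemma not_breaks_down n (x : 'rV[R]_n) (g : nat) : (0 < n)%N ->
  (forall r : nat, (0 < r < shat n x)%N ->
     0 < loglik f x (eta n (shat n x) x) - loglik f x (eta n r x)
         - 2^-1 * (5 * g%:R + 3 * (shat n x)%:R - 3 * r%:R + 2 * n%:R)
           * ln (n + g)%:R
         + n%:R * ln n%:R) ->
  ~ breaks_down (BIC_estimator eta shat) x g.
Proof.
move=> n0; set s := shat n x; set etas := eta n s x => gap.
have s0 : (0 < s)%N by exact: shat_gt0.
have ng0 : (0 < n + g)%N by rewrite addn_gt0 n0.
have [adms _] : is_mle f sigma0 x etas by exact: eta_mle.
have [eps eps0 gapeps] := positive_lower_bound (fun (r : 'I_s) (r0 : (0 < r)%N) =>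
  gap r (introT andP (conj r0 (ltn_ord r)))).
pose lng : R := ln (n + g)%:R; rewrite -/lng in gap gapeps.
have lng0 : 0 <= lng by rewrite ln_ge0 // ler1n.
(* One less than what the BIC of the spiked competitor forces on the log-likelihood of the fit at
   [x]. *)
pose l := n%:R * ln n%:R - (n%:R + g%:R) * lng + loglik f x etas
          - 3 / 2 * (s%:R + g%:R) * lng - 1.
have [d d0 dP] := loglik_drop_far f_sym f_decr f_pos sigma0_gt0 x l n0 eps0.
have [X xX] := row_bounded x.
have [K1 [K2 [_ _ offP]]] :=
  loc_scale_off_box f_density f_sym f_decr f_pos sigma0_gt0 X 0 d0.
move=> /(_ _ (box_params_compact s K1 K2 sigma0_gt0))[y] /=.
set z := row_mx x y; set t := shat _ z; set etat := eta _ t z => nobox.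
have t0 : (0 < t)%N by exact: shat_gt0.
have [admt _] : is_mle f sigma0 z etat by exact: eta_mle.
have sct j : sigma0 <= scales etat 0 j by case: admt.
pose N := [set j | in_box K1 K2 (locs etat 0 j) (scales etat 0 j)]%SET.
(* Otherwise [s] of the components in the box would witness [has_components_in]. *)
have Ns : (#|N| < s)%N.
  rewrite ltnNge; apply/negP => sN; apply: nobox.
  exists (fun k => enum_val (widen_ord sN k)).
    by move=> k k' /enum_val_inj[] /val_inj.
  split=> /= k; rewrite mxE in_itv /=;
    have := enum_valP (widen_ord sN k); rewrite inE => /andP[aK sK].
    by rewrite -ler_norml.
  by rewrite sct.
have Nt : (#|N| <= t)%N by rewrite -[leqRHS]card_ord max_card.
pose w : R := (n + g)%:R^-1.
have ng0R : 0 < (n + g)%:R :> R by rewrite ltr0n.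
have n0R : 0 < n%:R :> R by rewrite ltr0n.
have w0 : 0 < w by rewrite invr_gt0.
have gwE : 1 - g%:R * w = n%:R / (n + g)%:R.
  by rewrite /w natrD; field; rewrite -natrD gt_eqF.
have gw1 : g%:R * w < 1 by rewrite -subr_gt0 gwE divr_gt0.
have spikeP (i : 'I_g) : exists k, y 0 i = y 0 k by exists i.
have := loglik_spiked_ge f_pos sigma0_gt0 x adms w0 gw1 spikeP.
have p0 : 0 < f 0 / sigma0 by exact: peak_gt0.
rewrite gwE ln_div ?posrE // lnM ?posrE // /w lnV ?posrE // -/lng -/z.
have := shat_optimal z ng0 (ltn_addr g s0)
  (spiked_admissible y adms (ltW w0) (ltW gw1)).
rewrite -/t -/etat -/lng natrD (loglik_row_mx f etat).
have := loglik_le_peak f_sym f_decr f_pos sigma0_gt0 admt y.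
have tlng : (#|N|%:R : R) * lng <= t%:R * lng by rewrite ler_wpM2r // ler_nat.
have Nlng : 0 <= (#|N|%:R : R) * lng by rewrite mulr_ge0.
have [|lel|[W0 leN]] := dP _ _ N admt.
- by move=> i j; rewrite inE => jN; exact: offP.
- rewrite /l in lel; lra.
(* Positive weight rules out an empty [N], so the gap applies with [r = #|N|]. *)
have N0 := sub_mixture_card_gt0 W0.
have [_ /(_ _ (sub_mixture_admissible admt W0))] := eta_mle x n0 N0.
have := gapeps (Ordinal Ns) N0 => /=.
have : n%:R * ln (\sum_(j in N) weights etat 0 j) <= 0.
  by rewrite mulr_ge0_le0 // ln_le0 // (partial_weight_le1 admt).
lra.
Qed.

Lemma breaks_down_at n (x : 'rV[R]_n) (g r : nat) : (0 < n)%N ->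
  (0 < r < shat n x)%N ->
  loglik f x (eta n (shat n x) x) - loglik f x (eta n r x)
    < 3 / 2 * ((shat n x)%:R - r%:R) * ln (n + g)%:R ->
  breaks_down (BIC_estimator eta shat) x g.
Proof.
move=> n0; set s := shat n x; set etas := eta n s x; set etar := eta n r x.
move=> /andP[r0 rs] gap.
have s0 : (0 < s)%N by exact: shat_gt0.
have [admr _] : is_mle f sigma0 x etar by exact: eta_mle.
(* For [g = 0] the gap would contradict the optimality of [s] on [x]. *)
have g0 : (0 < g)%N.
  rewrite lt0n; apply/eqP => g0; move: gap; rewrite g0 addn0.
  have := shat_optimal x n0 r0 admr; rewrite -/etas -/s -/etar; lra.
have ng0 : (0 < n + g)%N by rewrite addn_gt0 n0.
pose lng : R := ln (n + g)%:R; rewrite -/lng in gap.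
have lng0 : 0 <= lng by rewrite ln_ge0 // ler1n.
have ng0R : 0 < (n + g)%:R :> R by rewrite ltr0n.
have n0R : 0 < n%:R :> R by rewrite ltr0n.
have g0R : 0 < g%:R :> R by rewrite ltr0n.
pose w : R := g%:R / (n + g)%:R.
have w0 : 0 < w by rewrite divr_gt0.
have wE : 1 - 1%:R * w = n%:R / (n + g)%:R.
  by rewrite /w natrD; field; rewrite -natrD gt_eqF.
have w1 : 1%:R * w < 1 by rewrite -subr_gt0 wE divr_gt0.
have p0 : 0 < f 0 / sigma0 by exact: peak_gt0.
(* A third of the slack: the approximations at [x] and at [y] cost [eps] each, and one [eps]
   remains. *)
pose eps := (3 / 2 * (s%:R - r%:R) * lng
             - (loglik f x etas - loglik f x etar)) / 3.
have eps0 : 0 < eps by rewrite divr_gt0 // subr_gt0.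
pose lp := ln (f 0 / sigma0).
(* The likelihood guaranteed by the spiked r-mixture. The thresholds below subtract the best
   possible likelihood on the other block of points, and 1 for strictness. *)
pose low := n%:R * ln (n%:R / (n + g)%:R) + loglik f x etar
            + g%:R * (ln w + lp).
have [d1 d10 d1P] := loglik_drop_far f_sym f_decr f_pos sigma0_gt0 x
  (low - g%:R * lp - 1) n0 eps0.
have [d2 d20 d2P] := sum_ln_perturb g (low - n%:R * lp - 1) p0 eps0.
move=> C cC; have [b bP] := compact_params_bounded cC.
have [X xX] := row_bounded x.
have [K1 [K2 [bK1 bK2 offP]]] :=
  loc_scale_off_box f_density f_sym f_decr f_pos sigma0_gt0 X b d10.
have [D farP] :=
  loc_scale_vanishes f_density f_sym f_decr sigma0_gt0 K1 d20.
(* This location is at distance at least [D] from every location in the box. *)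
exists (const_mx (D + K2)) => /=; set y := const_mx _.
set z := row_mx x y; set t := shat _ z; set etat := eta _ t z => -[j j_inj Cj].
have t0 : (0 < t)%N by exact: shat_gt0.
have [admt _] : is_mle f sigma0 z etat by exact: eta_mle.
have sct k : sigma0 <= scales etat 0 k by case: admt.
pose N := [set k | in_box K1 K2 (locs etat 0 k) (scales etat 0 k)]%SET.
have sN : (s <= #|N|)%N.
  rewrite -[leqLHS]card_ord -(card_imset _ j_inj); apply/subset_leq_card.
  apply/fintype.subsetP => _ /imsetP[k _ ->].
  have := bP _ Cj k; rewrite !mxE inE /in_box => -[aK sK].
  by rewrite (le_trans aK) // (le_trans sK).
have Nt : (#|N| <= t)%N by rewrite -[leqRHS]card_ord max_card.
pose W := \sum_(k in N) weights etat 0 k.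
have W1 : W <= 1 by exact: (partial_weight_le1 admt).
have WC : \sum_(k in ~: N) weights etat 0 k = 1 - W by exact: (partial_weightC admt).
have spikeP (i : 'I_g) : exists k, y 0 i = (const_mx (D + K2) : 'rV[R]_1) 0 k.
  by exists 0; rewrite !mxE.
have := loglik_spiked_ge f_pos sigma0_gt0 x admr w0 w1 spikeP.
rewrite wE lnM ?posrE // -/lp -/low.
have := shat_optimal z ng0 (ltn_addr 1 r0)
  (spiked_admissible (const_mx (D + K2)) admr (ltW w0) (ltW w1)).
rewrite -/t -/etat -/lng natrD -/z (loglik_row_mx f etat).
have upx := loglik_le_peak f_sym f_decr f_pos sigma0_gt0 admt x.
have upy := loglik_le_peak f_sym f_decr f_pos sigma0_gt0 admt y.
rewrite -/lp in upx upy.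
have ler_lng (a c : nat) : (a <= c)%N -> (a%:R : R) * lng <= c%:R * lng.
  by move=> ac; rewrite ler_wpM2r // ler_nat.
have Nlng := ler_lng _ _ Nt; have slng := ler_lng _ _ sN.
have := ler_lng _ _ rs; rewrite -natr1 => rlng.
have [|lel|[W0 leN]] := d1P _ _ N admt.
- by move=> i k; rewrite inE => kN; exact: offP.
- lra.
(* At the far points the box components add at most [d2], and the others at most their weight
   [1 - W] times the peak. *)
have [i|i|ley|[y0 ley]] := d2P (fun=> (1 - W) * (f 0 / sigma0))
    (fun i => mix_density f etat (y 0 i)).
- by rewrite mulr_ge0 ?subr_ge0 ?(ltW p0) //= ler_piMl ?(ltW p0) // gerBl ltW.
- rewrite (mix_density_gt0 f_pos sigma0_gt0 admt) /=.
  apply: le_trans (mix_density_le_add admt (N := ~: N) (ltW d20) _) _.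
    move=> k; rewrite !inE negbK => /andP[aK sK]; apply: farP.
      by rewrite sct.
    rewrite mxE (le_trans _ (ler_norm _)) //.
    by have := ler_norm (locs etat 0 k); lra.
  rewrite lerD2r -WC; apply: (partial_density_le admt) => k _.
  exact: (loc_scale_le_peak f_sym f_decr f_pos sigma0_gt0 admt).
- rewrite -/(loglik f y etat) in ley; lra.
rewrite -/(loglik f y etat) in ley.
move: y0 => /(_ (Ordinal g0)); rewrite pmulr_lgt0 // => W'0.
move: ley; rewrite -mulr_natl_sum lnM ?posrE // -/lp => ley.
(* The weight [1 - W] is positive, so some component lies outside the box; its penalty offsets that
   of the competitor's spike. *)
have NtS : (#|N|.+1 <= t)%N.
  rewrite ltn_neqAle Nt andbT; apply/eqP => NtE; move: W'0; rewrite -WC.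
  have /eqP := cardsC N; rewrite card_ord NtE -[X in _ == X]addn0 eqn_add2l.
  by rewrite cards_eq0 => /eqP ->; rewrite big_set0 ltxx.
have := ler_lng _ _ NtS; rewrite -natr1 => NtSlng.
have Wlt1 : W < 1 by rewrite -subr_gt0.
have := gibbs2 n0R g0R (W0 : 0 < W) Wlt1.
rewrite -(natrD _ n g) -/w => gib.
have := shat_optimal x n0 (sub_mixture_card_gt0 W0) (sub_mixture_admissible admt W0).
rewrite -/s -/etas.
have lnn : ln n%:R <= lng by rewrite ler_ln_pos // ler_nat leq_addr.
have : (#|N|%:R - s%:R) * ln n%:R <= (#|N|%:R - s%:R) * lng.
  by rewrite ler_wpM2l // subr_ge0 ler_nat.
(* With m = [#|N|], the bounds give 3/2 (m - r) [lng] <= L_m - L_r + 2 [eps] and L_m - L_s <= 3/2 (m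
   - s) [lng], hence 3 [eps] <= 2 [eps]. *)
rewrite -/W in leN; rewrite /low /eps in gib leN ley *; lra.
Qed.

End Breakdown.

Theorem theorem4p13 (R : realType) (f : R -> R) (sigma0 : R)
  (f_density : is_density f)
  (f_sym : forall x, f (- x) = f x)
  (f_decr : forall x y, 0 <= x -> x <= y -> f y <= f x)
  (f_pos : forall x, 0 < f x)
  (f_cont : continuous f)
  (sigma0_gt0 : 0 < sigma0)
  (eta : forall n s : nat, 'rV[R]_n -> mixture R s)
  (eta_mle : forall (n s : nat) (x : 'rV[R]_n), (0 < n)%N -> (0 < s)%N ->
     is_mle f sigma0 x (eta n s x))
  (shat : forall n : nat, 'rV[R]_n -> nat)
  (shat_max : forall (n : nat) (x : 'rV[R]_n), (0 < n)%N ->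
     maximizes_BIC f eta x (shat n x))
  (n : nat) (n_gt0 : (0 < n)%N) (x : 'rV[R]_n) (g : nat) :
  let s := shat n x in
  let L := maxL f eta x in
  let B := breakdown_point (BIC_estimator eta shat) x in
  ((0 < \big[mine/+oo]_(r < s)
          (L s - L r
           - (2^-1 * (5 * g%:R + 3 * s%:R - 3 * r%:R + 2 * n%:R)
              * ln (n + g)%:R)%:E
           + (n%:R * ln n%:R)%:E))%E ->
   ((g%:R / (n + g)%:R)%:E < B)%E) /\
  ((\big[mine/+oo]_(r < s)
      (L s - L r - (3 / 2 * (s%:R - r%:R) * ln (n + g)%:R)%:E) < 0)%E ->
   (B <= (g%:R / (n + g)%:R)%:E)%E).
Proof.
move=> s L B; have s0 : (0 < s)%N by exact: (shat_gt0 shat_max).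
have LE r : (0 < r)%N -> L r = (loglik f x (eta n r x))%:E.
  by move=> r0; rewrite /L /maxL gtn_eqF.
(* In this form the fraction is visibly increasing in [h]. *)
have fracE (h : nat) : h%:R / (n + h)%:R = 1 - n%:R / (n + h)%:R :> R.
  have nh0 : n%:R + h%:R != 0 :> R by rewrite -natrD pnatr_eq0 addn_eq0 gtn_eqF.
  by rewrite natrD; field.
split.
  move=> /bigmin_gtP[_ gap].
  (* Strictness survives the infimum because every [h] that breaks the estimator down is at least
     [g.+1]. *)
  apply: (@lt_le_trans _ _ (g.+1%:R / (n + g.+1)%:R)%:E).
    rewrite lte_fin !fracE ltrD2l ltrN2 ltr_pM2l ?ltr0n //.
    by rewrite ltf_pV2 ?posrE ?ltr0n ?addn_gt0 ?n_gt0 // ltr_nat addnS.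
  apply: le_ereal_inf_tmp => _ [h bh <-].
  have [gh|hg] := ltnP g h.
    rewrite lee_fin !fracE lerD2l lerN2 ler_pM2l ?ltr0n //.
    by rewrite lef_pV2 ?posrE ?ltr0n ?addn_gt0 ?n_gt0 // ler_nat leq_add2l.
  exfalso; move: bh; apply: (not_breaks_down f_density f_sym f_decr f_pos
    sigma0_gt0 eta_mle shat_max n_gt0) => r /andP[r0 rs].
  (* The subtracted term is nondecreasing in the number of added points, so the gap for [g] implies
     the gap for [h <= g]. *)
  have := gap (Ordinal rs) isT; rewrite !LE // lte_fin => /lt_le_trans; apply.
  rewrite lerD2r lerD2l lerN2; apply: ler_pM.
  - rewrite mulr_ge0 ?invr_ge0 //.
    have : r%:R <= s%:R :> R by rewrite ler_nat ltnW.
    have := ler0n R n; have := ler0n R h; rewrite /s; lra.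
  - by rewrite ln_ge0 // ler1n addn_gt0 n_gt0.
  - have : h%:R <= g%:R :> R by rewrite ler_nat.
    rewrite /s; lra.
  - by rewrite ler_ln_pos ?ltr0n ?addn_gt0 ?n_gt0 // ler_nat leq_add2l.
(* Neither the default +oo nor the term at [r = 0], which is +oo because L_0 is -oo, is negative; so
   some [r >= 1] attains a negative value. *)
move=> /bigmin_ltP[|[[r rs] _ /=]]; first by rewrite ltNge leey.
have [->|r0] := posnP r; first by rewrite LE // /L /maxL eqxx.
rewrite !LE // lte_fin subr_lt0 => gap.
apply: ereal_inf_lbound; exists g => //.
by apply: (breaks_down_at f_density f_sym f_decr f_pos sigma0_gt0 eta_mle
  shat_max n_gt0 (r := r)); rewrite ?r0.
Qed.
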